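(* Let $X=c_0$ or $X=\ell_p$ with $p\in[1,+\infty)$, let $d\in\mathbb N$, let $\beta\in(0,1]$ and let $\Lambda\subset(0,+\infty)^d$ be a $\beta$-Hölder curve, i.e. $\Lambda=f([0,1])$ for some $f:[0,1]\to\mathbb R^d$ for which there is $\rho>0$ with $\|f(s)-f(t)\|\le\rho|s-t|^\beta$ for all $s,t\in[0,1]$. For $\alpha>0$, consider the family of weights $(w(x))_{x>0}$, $w(x)=(w_n(x))_{n\in\mathbb N}$, defined by $w_1(x)\cdots w_n(x)=\exp(xn^\alpha)$ for all $n\in\mathbb N$ and $x>0$. If $\alpha\in(0,\beta]$, then $$\bigcap_{\lambda=(\lambda_1,\dots,\lambda_d)\in\Lambda}HC\big(B_{w(\lambda_1)}\times\cdots\times B_{w(\lambda_d)}\big)\neq\varnothing.$$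
   Context: $X$ is a space of sequences $(x_0,x_1,x_2,\dots)$ indexed by $\mathbb N_0$. For a sequence of positive weights $w=(w_n)_{n\in\mathbb N}$, the weighted backward shift is $B_w(x_0,x_1,x_2,\dots)=(w_1x_1,w_2x_2,\dots)$. The operator $B_{w(\lambda_1)}\times\cdots\times B_{w(\lambda_d)}$ acts coordinatewise on the $d$-fold product $X^d$. For an operator $T$ on a topological vector space $Y$, $HC(T)$ is the set of hypercyclic vectors of $T$, i.e. the vectors $u\in Y$ whose orbit $\{T^nu:n\ge0\}$ is dense in $Y$. $\mathbb R^d$ carries the maximum norm. *)

(* Defs.v *)
From HB Require Import structures.
From mathcomp Require Import all_boot all_order all_algebra.
From mathcomp Require Import complex.
From mathcomp Require Import all_classical all_reals all_analysis.

Set Implicit Arguments.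
Unset Strict Implicit.
Unset Printing Implicit Defensive.

Import Order.TTheory GRing.Theory Num.Theory.
Import numFieldNormedType.Exports.

Local Open Scope classical_set_scope.
Local Open Scope ring_scope.

(* [Rcomplex R] is C with its modulus, seen as a normed space over R. *)
Section Rcomplex_normedMod.
Variable R : realType.

HB.instance Definition _ :=
  PseudoMetric.copy (Rcomplex R) (pseudoMetric_normed (Rcomplex R)).
HB.instance Definition _ := isPointed.Build (Rcomplex R) 0.
HB.instance Definition _ :=
  NormedZmod_PseudoMetric_eq.Build R (Rcomplex R) erefl.

Lemma Rcomplex_normrZ (l : R) (x : Rcomplex R) : `|l *: x| = `|l| * `|x|.
Proof.
case: x => a b; rewrite /Num.norm/= /Normc.normc/=.
rewrite !exprMn -mulrDr sqrtrM ?sqr_ge0//; congr (_ * _).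
by rewrite sqrtr_sqr.
Qed.

HB.instance Definition _ :=
  PseudoMetricNormedZmod_Lmodule_isNormedModule.Build R (Rcomplex R)
    Rcomplex_normrZ.
End Rcomplex_normedMod.

(* Only real multiples enter the orbits of a shift with real weights, so the
   sequence spaces over R and over C are both treated as real normed spaces. *)
Inductive scalar_field := RealField | ComplexField.

Definition scalars (R : realType) (k : scalar_field) : normedModType R :=
  match k with RealField => R^o | ComplexField => Rcomplex R end.

Inductive seq_space (R : realType) := Czero | Ell (p : R) of 1 <= p.
Arguments Czero {R}.

Section SeqSpace.
Context {R : realType} (V : normedModType R).
Implicit Types (x y : nat -> V) (X : seq_space R).

Definition pow_sum (p : R) x : \bar R :=
  (\sum_(0 <= n <oo) (`|x n| `^ p)%:E)%E.

Definition in_space X x : Prop :=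
  match X with
  | Czero => x @ \oo --> (0 : V)
  | Ell p _ => (pow_sum p x < +oo)%E
  end.

Definition space_norm X x : R :=
  match X with
  | Czero => sup (range (fun n => `|x n|))
  | Ell p _ => fine (pow_sum p x) `^ p^-1
  end.

Section ell.
Variables (p : R) (p1 : 1 <= p).
Let p0 : 0 < p. Proof. exact: lt_le_trans p1. Qed.
Let S := pow_sum p.

Let S_ge0 x : (0 <= S x)%E.
Proof. by rewrite /S /pow_sum; apply: nneseries_ge0 => n _ _; rewrite lee_fin powR_ge0. Qed.

Let Lnorm_S x :
  ('N[@counting nat R]_(p%:E)[EFin \o (fun n => (`|x n| : R))%R] = S x `^ p^-1)%E.
Proof.
rewrite Lnorm_counting//; congr (_ `^ _)%E.
by apply: eq_eseriesr => n _; rewrite /= normr_id.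
Qed.

Let S_triangle x y : (S (x + y)%R `^ p^-1 <= S x `^ p^-1 + S y `^ p^-1)%E.
Proof.
rewrite -!Lnorm_S.
apply: le_trans; last exact: minkowski_EFin.
rewrite !Lnorm_counting//; apply: gt0_ler_poweR.
- by rewrite invr_ge0 ltW.
- by rewrite in_itv/= leey andbT; apply: nneseries_ge0 => n _ _; rewrite ?poweR_ge0 ?lee_fin ?powR_ge0.
- by rewrite in_itv/= leey andbT; apply: nneseries_ge0 => n _ _; rewrite ?poweR_ge0 ?lee_fin ?powR_ge0.
apply: lee_nneseries => n _; first by rewrite ?poweR_ge0 ?lee_fin ?powR_ge0.
rewrite /= !normr_id lee_fin ge0_ler_powR ?nnegrE ?(ltW p0)//.
rewrite ger0_norm ?addr_ge0//; exact: ler_normD.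
Qed.

Let S_scale a x : S (a *: x) = ((`|a| `^ p)%:E * S x)%E.
Proof.
rewrite /S /pow_sum -nneseriesZl => [|n _]; last by rewrite lee_fin powR_ge0.
by apply: eq_eseriesr => n _; rewrite -EFinM -powRM// -normrZ.
Qed.

Lemma ell_add x y : in_space (Ell p1) x -> in_space (Ell p1) y ->
  in_space (Ell p1) (x + y).
Proof.
rewrite /in_space -!/(S _) => Sx Sy.
apply: (@lty_poweRy _ _ p^-1); first by rewrite invr_neq0 ?gt_eqF.
by rewrite (le_lt_trans (S_triangle x y))// lte_add_pinfty// poweR_lty.
Qed.

Lemma ell_scale a x : in_space (Ell p1) x -> in_space (Ell p1) (a *: x).
Proof.
rewrite /in_space -!/(S _) => Sx.
by rewrite S_scale -(fineK (_ : S x \is a fin_num)) ?ge0_fin_numE// -EFinM ltry.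
Qed.

Lemma ell_0 : in_space (Ell p1) 0.
Proof.
rewrite /in_space /pow_sum eseries0 ?ltry// => n _ _.
by rewrite normr0 powR0// gt_eqF.
Qed.

Let normE x : in_space (Ell p1) x ->
  ((space_norm (Ell p1) x)%:E = S x `^ p^-1)%E.
Proof.
move=> Sx; rewrite /space_norm -poweR_EFin; congr (_ `^ _)%E.
by rewrite fineK// ge0_fin_numE//; exact: S_ge0.
Qed.

Lemma ell_normD x y : in_space (Ell p1) x -> in_space (Ell p1) y ->
  space_norm (Ell p1) (x + y) <= space_norm (Ell p1) x + space_norm (Ell p1) y.
Proof.
move=> xX yX.
have aux (a b c : R) (A B C : \bar R) :
    a%:E = A -> b%:E = B -> c%:E = C -> (A <= B + C)%E -> a <= b + c.
  by move=> <- <- <-.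
exact: (aux _ _ _ _ _ _ (normE (ell_add xX yX)) (normE xX) (normE yX)
  (S_triangle x y)).
Qed.

Lemma ell_normZ a x : in_space (Ell p1) x ->
  space_norm (Ell p1) (a *: x) = `|a| * space_norm (Ell p1) x.
Proof.
rewrite /in_space /space_norm -!/(S _) => Sx.
rewrite S_scale fineM ?ge0_fin_numE ?lee_fin ?powR_ge0 ?ltry//=.
rewrite powRM ?powR_ge0 ?fine_ge0// -powRrM divff ?gt_eqF// powRr1//.
Qed.

Lemma ell_norm_eq0 x : in_space (Ell p1) x ->
  space_norm (Ell p1) x = 0 -> x = 0.
Proof.
rewrite /in_space /space_norm -!/(S _) => Sx.
move=> /powR_eq0_eq0 S0; apply/funext => n; rewrite -[RHS]/(0 : V).
have : ((`|x n| `^ p)%:E <= S x)%E.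
  rewrite /S /pow_sum (nneseries_split 0 n.+1); last first.
    by move=> k _; rewrite lee_fin powR_ge0.
  rewrite add0n big_nat_recr//= -addeA addeCA leeDl// adde_ge0//.
    by apply: sume_ge0 => k _; rewrite lee_fin powR_ge0.
  by rewrite nneseries_ge0// => k _ _; rewrite lee_fin powR_ge0.
have -> : S x = 0%E.
  by rewrite -(fineK (_ : S x \is a fin_num)) ?S0// ge0_fin_numE//; exact: S_ge0.
rewrite lee_fin => xn0; apply/normr0_eq0/(@powR_eq0_eq0 _ _ p)/eqP.
by rewrite eq_le xn0 powR_ge0.
Qed.
End ell.

Lemma czero_0 : in_space Czero 0.
Proof. rewrite /in_space; exact: cvg_cst. Qed.

Lemma czero_scale a x : in_space Czero x -> in_space Czero (a *: x).
Proof.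
rewrite /in_space => x0; rewrite -[X in _ --> X](scaler0 _ a).
exact: cvgZr.
Qed.

Lemma czero_sup x : in_space Czero x -> has_sup (range (fun n => `|x n|)).
Proof.
move=> x0; split; first by exists `|x 0%N|, 0%N.
have /cvg_seq_bounded/pinfty_ex_gt0[M M0 xM] := cvgP _ x0.
by exists M => _ [n _ <-]; exact: xM.
Qed.

Lemma czero_le x n : in_space Czero x -> `|x n| <= space_norm Czero x.
Proof. by move=> /czero_sup xs; apply: ub_le_sup; [case: xs|exists n]. Qed.

Lemma in_space_submod X : submod_closed [pred x | `[< in_space X x >]].
Proof.
split; first by apply: (@asboolT (in_space X 0)); case: X => [|p p1];
  [exact: czero_0|exact: ell_0].
move=> a x y /(@asboolW (in_space X x)) xX /(@asboolW (in_space X y)) yX.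
apply: (@asboolT (in_space X (a *: x + y))).
case: X xX yX => [|p p1] xX yX; last first.
  exact: (ell_add (ell_scale a xX) yX).
have := czero_scale a xX; move: yX; rewrite /in_space => yX axX.
rewrite -[X in _ --> X](addr0 (0 : V)); exact: (cvgD axX yX).
Qed.

Lemma space_normD X x y : in_space X x -> in_space X y ->
  space_norm X (x + y) <= space_norm X x + space_norm X y.
Proof.
case: X => [|p p1] xX yX; last exact: ell_normD.
apply: ge_sup; first by exists `|(x + y) 0%N|, 0%N.
move=> _ [n _ <-]; rewrite -[(x + y) n]/(x n + y n) (le_trans (ler_normD _ _))//.
by rewrite lerD// czero_le.
Qed.

Lemma space_normZ X a x : in_space X x ->
  space_norm X (a *: x) = `|a| * space_norm X x.
Proof.
case: X => [|p p1] xX; last exact: ell_normZ.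
have le b y : in_space Czero y ->
    space_norm Czero (b *: y) <= `|b| * space_norm Czero y.
  move=> yX; apply: ge_sup; first by exists `|(b *: y) 0%N|, 0%N.
  by move=> _ [n _ <-]; rewrite -[(b *: y) n]/(b *: y n) normrZ ler_wpM2l// czero_le.
have [->|a0] := eqVneq a 0.
  rewrite scale0r normr0 mul0r; apply/eqP; rewrite eq_le; apply/andP; split.
    by have := le 0 _ xX; rewrite scale0r normr0 mul0r.
  by rewrite -[leLHS](@normr0 _ V) (@czero_le 0 0%N)//; exact: czero_0.
apply/eqP; rewrite eq_le le//= mulrC -ler_pdivlMr ?normr_gt0//.
rewrite mulrC -normfV -[in leLHS](scalerK a0 x) le//.
exact: czero_scale.
Qed.

Lemma space_norm_eq0 X x : in_space X x -> space_norm X x = 0 -> x = 0.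
Proof.
case: X => [|p p1] xX; last exact: ell_norm_eq0.
move=> x0; apply/funext => n; apply/normr0_eq0/eqP.
by rewrite eq_le normr_ge0 andbT -x0; exact: czero_le.
Qed.

End SeqSpace.

Section Seqsp.
Context {R : realType} (V : normedModType R) (X : seq_space R).

Definition seqsp_pred : pred (nat -> V) := fun x => `[< in_space X x >].

HB.instance Definition _ := GRing.isSubmodClosed.Build R (nat -> V) seqsp_pred
  (@in_space_submod R V X).

Record seqsp := Seqsp { seqsp_val :> nat -> V; _ : seqsp_val \in seqsp_pred }.

HB.instance Definition _ := [isSub for seqsp_val].
HB.instance Definition _ := [Choice of seqsp by <:].
HB.instance Definition _ := [SubChoice_isSubLmodule of seqsp by <:].

Lemma seqspP (x : seqsp) : in_space X x.
Proof. by case: x => x /= /(@asboolW (in_space X x)). Qed.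

Definition seqsp_norm (x : seqsp) : R := space_norm X x.

Lemma seqsp_normD x y : seqsp_norm (x + y) <= seqsp_norm x + seqsp_norm y.
Proof. by apply: space_normD; exact: seqspP. Qed.

Lemma seqsp_normZ a x : seqsp_norm (a *: x) = `|a| * seqsp_norm x.
Proof. by apply: space_normZ; exact: seqspP. Qed.

Lemma seqsp_norm_eq0 x : seqsp_norm x = 0 -> x = 0.
Proof. by move=> x0; apply/val_inj/(space_norm_eq0 (seqspP x) x0). Qed.

HB.instance Definition _ := Lmodule_isNormed.Build R seqsp
  seqsp_normD seqsp_normZ seqsp_norm_eq0.

(* The weights are w 1, w 2, ...; the value w 0 is not used. *)
Definition wshift_seq (w : nat -> R) (x : nat -> V) : nat -> V :=
  fun n => w n.+1 *: x n.+1.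

(* The default value 0 of [insubd] is taken only outside the domain of the
   shift; for bounded weights it never is, see [wshiftE], and the weights with
   w 1 * ... * w n = exp (x n^alpha), alpha <= 1, are bounded, see
   [wshift_weight_bound]. *)
Definition wshift (w : nat -> R) (x : seqsp) : seqsp :=
  insubd (0 : seqsp) (wshift_seq w x).

Lemma in_space_wshift (w : nat -> R) (M : R) (x : nat -> V) :
  (forall n, `|w n.+1| <= M) -> in_space X x -> in_space X (wshift_seq w x).
Proof.
move=> wM; rewrite /in_space; case: X => [x0|p p1 xX].
  have M0 : 0 <= M by exact: le_trans (wM 0%N).
  have M1 : 0 < M + 1 by rewrite ltr_wpDl.
  have sx : (fun n => x n.+1) @ \oo --> (0 : V) by rewrite (cvg_shiftS x).
  apply/cvgr0Pnorm_lt => e e0; near=> n.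
  have xe : `|x n.+1| < e / (M + 1).
    by near: n; apply: (cvgr0_norm_lt _ sx); rewrite divr_gt0.
  rewrite /wshift_seq normrZ (@le_lt_trans _ _ ((M + 1) * `|x n.+1|))//.
    by rewrite ler_wpM2r// (le_trans (wM n))// lerDl.
  by rewrite mulrC -ltr_pdivlMr.
have p0 : 0 <= p by rewrite (le_trans _ p1).
have le_ n : ((`|wshift_seq w x n| `^ p)%:E <= (M `^ p)%:E * (`|x n.+1| `^ p)%:E)%E.
  rewrite -EFinM lee_fin -powRM ?(le_trans _ (wM 0%N))//.
  rewrite ge0_ler_powR ?nnegrE ?mulr_ge0 ?(le_trans _ (wM 0%N))//.
  by rewrite normrZ ler_wpM2r.
rewrite /pow_sum; apply: le_lt_trans; first by apply: lee_nneseries => n _;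
  [rewrite lee_fin powR_ge0|exact: le_].
rewrite nneseriesZl => [|n _]; last by rewrite lee_fin powR_ge0.
have : (\sum_(0 <= n <oo) (`|x n.+1| `^ p)%:E <= pow_sum p x)%E.
  apply: lime_le; first by apply: is_cvg_nneseries => n _ _; rewrite lee_fin powR_ge0.
  near=> n; rewrite /pow_sum (nneseries_split 0 n.+1); last first.
    by move=> k _; rewrite lee_fin powR_ge0.
  rewrite add0n big_nat_recl//= -[leLHS]add0e -addeA leeD ?lee_fin ?powR_ge0//.
  by rewrite leeDl// nneseries_ge0// => k _ _; rewrite lee_fin powR_ge0.
move=> /le_lt_trans/(_ xX) h.
rewrite lte_mul_pinfty ?lee_fin ?powR_ge0//.
Unshelve. all: by end_near.
Qed.

Lemma wshiftE (w : nat -> R) (M : R) (x : seqsp) :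
  (forall n, `|w n.+1| <= M) ->
  forall n, wshift w x n = w n.+1 *: x n.+1.
Proof.
move=> wM n; have wxX := asboolT (in_space_wshift wM (seqspP x)).
by rewrite /wshift insubdK.
Qed.

End Seqsp.

Lemma wshift_weight_bound (R : realType) (alpha x : R) (w : nat -> R) :
  0 < alpha <= 1 -> 0 < x -> (forall n, (0 < n)%N -> 0 < w n) ->
  (forall n, (0 < n)%N ->
    \prod_(1 <= k < n.+1) w k = expR (x * n%:R `^ alpha)) ->
  forall n, `|w n.+1| <= expR x.
Proof.
move=> /andP[a0 a1] x0 w0 wE n; rewrite gtr0_norm ?w0//.
have powS : n.+1%:R `^ alpha <= n%:R `^ alpha + 1 :> R.
  have s0 : (0 : R) < n.+1%:R by rewrite ltr0n.
  have le_pow t : 0 <= t <= 1 -> t <= t `^ alpha.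
    move=> /andP[t0 t1]; have [->|tN0] := eqVneq t 0; first exact: powR_ge0.
    by rewrite -[leLHS]powRr1// ger_powR// lt0r tN0 t0.
  have t1 : 0 <= (n%:R / n.+1%:R : R) <= 1.
    apply/andP; split; first exact: divr_ge0.
    by rewrite ler_pdivrMr// mul1r ler_nat.
  have i1 : 0 <= (n.+1%:R^-1 : R) <= 1.
    by rewrite invr_ge0 ltW//= invf_le1// ler1n.
  have sN0 : n.+1%:R != 0 :> R by rewrite pnatr_eq0.
  have nE : n%:R `^ alpha = (n%:R / n.+1%:R) `^ alpha * n.+1%:R `^ alpha :> R.
    by rewrite -powRM ?divr_ge0// divfK.
  have oneE : 1 = n.+1%:R^-1 `^ alpha * n.+1%:R `^ alpha :> R.
    by rewrite -powRM ?invr_ge0// mulVf// powR1.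
  have sE : n.+1%:R `^ alpha =
      n%:R / n.+1%:R * n.+1%:R `^ alpha + n.+1%:R^-1 * n.+1%:R `^ alpha :> R.
    by rewrite -mulrDl -[X in _ + X]mul1r -mulrDl natr1 divff// mul1r.
  rewrite sE nE; apply: lerD; last rewrite [leRHS]oneE;
    by rewrite ler_wpM2r ?powR_ge0//; exact: le_pow.
have En m : \prod_(1 <= k < m.+1) w k = expR (x * m%:R `^ alpha).
  case: m => [|m]; last exact: wE.
  by rewrite big_nil powR0 ?mulr0 ?expR0// gt_eqF.
have := En n.+1; rewrite big_nat_recr//= En => wnE.
have -> : w n.+1 = expR (x * (n.+1%:R `^ alpha - n%:R `^ alpha)).
  rewrite mulrBr expRD expRN -wnE mulrC mulrA mulVf ?mul1r//.
  by rewrite gt_eqF ?expR_gt0.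
by rewrite ler_expR -[leRHS]mulr1 ler_wpM2l ?(ltW x0)// lerBlDl.
Qed.

Definition hypercyclic_vectors (Y : topologicalType) (T : Y -> Y) : set Y :=
  [set u | dense (range (fun n => iter n T u))].

(* For finite 'I_d, the topology of pointwise convergence is that of Y^d. *)
Definition prod_op (d : nat) (Y : topologicalType) (T : 'I_d -> Y -> Y)
    (u : {ptws 'I_d -> Y}) : {ptws 'I_d -> Y} :=
  fun i => T i (u i).

(* The norm on 'rV[R]_d is the maximum norm [mx_norm]; only the restriction of f
   to `[0, 1] matters. *)
Definition holder_curve (R : realType) (d : nat) (beta : R)
    (Lambda : set 'rV[R]_d) : Prop :=
  exists2 f : R -> 'rV[R]_d,
    exists2 rho : R, 0 < rho &
      forall s t : R, s \in `[0, 1] -> t \in `[0, 1] ->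
        `|f s - f t| <= rho * `|s - t| `^ beta
    & Lambda = f @` `[0, 1].

(* Main.v *)
Require Import Defs.
From mathcomp Require Import all_boot all_order all_algebra.
From mathcomp Require Import complex.
From mathcomp Require Import all_classical all_reals all_analysis.
From mathcomp Require Import ring lra.

Set Implicit Arguments.
Unset Strict Implicit.
Unset Printing Implicit Defensive.

Import Order.TTheory GRing.Theory Num.Theory.
Import numFieldNormedType.Exports.

Local Open Scope classical_set_scope.
Local Open Scope ring_scope.

(* A beta-Hölder curve on [0, 1] is alpha-Hölder, so we may take beta = alpha;
   by compactness all coordinates of the curve lie in some [a, b], a > 0.
   Write B_t for the product of shifts with parameter f(t). For a finitely
   supported v, put u = sum_{1 <= l <= J} (right inverse of B_(t_l))^(l N) v,
   where t_1 = 0 and t_(l+1) - t_l = c / (l N), truncated at 1. The harmonic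
   series diverges, so the intervals [t_j, t_(j+1)] cover [0, 1] for J large.
   If t is in the j-th one, then B_t^(j N) u is close to v:
   - the term l < j is killed, as N exceeds the support of v;
   - the term l = j differs from v by factors exp(y) with |y| <= rho c^alpha;
   - a coordinate of the term l > j carries a factor at most
     const * exp(- (a/2) ((l - j) N)^alpha). When l >= K j this comes from
     b (j N)^alpha <= (a/2) (l N)^alpha; when l < K j, the error
     |f(t) - f(t_l)| (l N + k)^alpha is at most
     rho (c (l - j) / (j N))^alpha (K j N)^alpha <= (a/2) (l - j)^alpha
     as soon as rho (c K)^alpha <= a/2.
   Such vectors for countably many v, each starting after the end of the
   previous one and much smaller than it, are summed to a common hypercyclic
   vector. All estimates are made in the l^1 norm, which dominates the norm
   of X. *)

(** * Elementary estimates for powers, exponentials and harmonic sums *)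

Section RealEstimates.
Variable R : realType.
Implicit Types (x y a b c : R) (n m l : nat).

(** The shares [x / (x + y)] and [y / (x + y)] sum to 1, and numbers in [0, 1] do not decrease when
    raised to a power [al <= 1]. *)
Lemma powR_le_addr x y (al : R) :
  0 <= x -> 0 <= y -> 0 < al <= 1 -> (x + y) `^ al <= x `^ al + y `^ al.
Proof.
move=> x0 y0 /andP[al0 al1].
have [s0|s0] := eqVneq (x + y) 0.
  by rewrite s0 powR0 ?gt_eqF// addr_ge0// powR_ge0.
have sp : 0 < x + y by rewrite lt0r s0 addr_ge0.
have le_share z : 0 <= z -> z <= x + y -> z / (x + y) <= (z / (x + y)) `^ al.
  move=> z0 zs; case: (eqVneq z 0) => [->|zN0]; first by rewrite mul0r powR_ge0.
  apply: ger1_powR => //; have zp : 0 < z by rewrite lt0r zN0.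
  by rewrite divr_gt0//= ler_pdivrMr// mul1r.
have shareE z : 0 <= z -> z `^ al = (z / (x + y)) `^ al * (x + y) `^ al.
  by move=> z0; rewrite -powRM ?divr_ge0 ?(ltW sp)// divfK.
rewrite (shareE x)// (shareE y)// -mulrDl ler_peMl ?powR_ge0//.
have lx : x <= x + y by rewrite lerDl.
have ly : y <= x + y by rewrite lerDr.
apply: le_trans (lerD (le_share _ x0 lx) (le_share _ y0 ly)).
by rewrite -mulrDl divff.
Qed.

Lemma sum_powR_le (p : R) (u : nat -> R) n : 1 <= p -> (forall k, 0 <= u k) ->
  \sum_(0 <= k < n) u k `^ p <= (\sum_(0 <= k < n) u k) `^ p.
Proof.
move=> p1 u0; have p0 : 0 < p by exact: lt_le_trans p1.
elim: n => [|n IHn]; first by rewrite !big_nil powR_ge0.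
rewrite !big_nat_recr//= (le_trans (lerD IHn (lexx _)))//.
set s := \sum_(_ <= _ < _) _; have s0 : 0 <= s by apply: sumr_ge0.
rewrite -(mulr_powRB1 s0 p0) -(mulr_powRB1 (u0 n) p0).
rewrite -(mulr_powRB1 (addr_ge0 s0 (u0 n)) p0) mulrDl.
by apply: lerD; apply: ler_wpM2l => //; apply: ge0_ler_powR;
  rewrite ?nnegrE ?subr_ge0 ?addr_ge0// ?lerDl ?lerDr.
Qed.

(** Once [2 <= (r + 1) al], the Taylor term of order [r + 1] of the exponential dominates [x ^+ 2]
    up to a constant. *)
Lemma expRN_powR_le (kappa al : R) : 0 < kappa -> 0 < al ->
  exists2 C : R, 0 < C &
    forall x, 1 <= x -> expR (- (kappa * x `^ al)) <= C / x ^+ 2.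
Proof.
move=> k0 al0.
have [r rP] : exists r, 2 / al <= r.+1%:R.
  by exists (Num.trunc (2 / al)); rewrite ltW ?truncnS_gt.
have f0 : 0 < (r.+1)`!%:R :> R by rewrite ltr0n fact_gt0.
exists ((r.+1)`!%:R / kappa ^+ r.+1); first by rewrite divr_gt0 ?exprn_gt0.
move=> x x1; have x0 : 0 < x by exact: lt_le_trans x1.
have y0 : 0 < kappa * x `^ al by rewrite mulr_gt0 ?powR_gt0.
have h := expR_ge1Dxn r (ltW y0).
have x2 : x ^+ 2 <= (x `^ al) ^+ r.+1.
  rewrite -!powR_mulrn ?powR_ge0 ?(ltW x0)// -powRrM ler_powR//.
  by rewrite mulrC -ler_pdivrMr.
rewrite expRN ler_pdivlMr ?exprn_gt0// mulrC ler_pdivrMr ?expR_gt0//.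
rewrite mulrAC ler_pdivlMr ?exprn_gt0// mulrC.
apply: (@le_trans _ _ ((kappa * x `^ al) ^+ r.+1)).
  by rewrite exprMn ler_wpM2l// exprn_ge0// ltW.
by rewrite -ler_pdivrMl// mulrC (le_trans _ h)// lerDr.
Qed.

Lemma sum_invsqr_le N L : (0 < N)%N ->
  \sum_(N <= h < L) (h%:R ^- 2 : R) <= 2 / N%:R.
Proof.
move=> N0; have [LN|] := leqP L N.
  by rewrite big_geq// divr_ge0.
elim: L => // L IHL NL; have {}NL : (N <= L)%N by [].
(* The subtracted [1 / L] makes the induction work: [(L + 1)^-2 <= 1 / L - 1 / (L + 1)]. *)
suff : \sum_(N <= h < L.+1) (h%:R ^- 2 : R) <= 2 / N%:R - 1 / L%:R.
  by move/le_trans; apply; rewrite gerBl divr_ge0.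
elim: L NL {IHL} => [|L IHL]; first by rewrite leqn0 => /eqP N00; rewrite N00 in N0.
rewrite leq_eqVlt => /predU1P[<-|NL].
  rewrite big_nat1 -mulrBl; have N1 : (1 : R) <= N%:R by rewrite ler1n.
  rewrite expr2 invfM ler_wpM2r ?invr_ge0//.
  by rewrite (le_trans (_ : _ <= 1)) ?invf_le1 ?ltr0n//; lra.
rewrite big_nat_recr ?(ltnW NL)//=.
have L0 : (0 < L)%N by exact: leq_trans N0 NL.
have Lp : 0 < L%:R :> R by rewrite ltr0n.
have {}IHL := IHL NL; rewrite -(natr1 L).
set t := L%:R in Lp IHL *; set S := \sum_(_ <= _ < _) _ in IHL *.
have -> : 2 / N%:R - 1 / (t + 1) =
    (2 / N%:R - 1 / t) + (t + 1) ^- 2 + (t * (t + 1) ^+ 2)^-1.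
  rewrite -!addrA; congr (_ + _); field; lra.
rewrite -[leLHS]addr0 lerD ?lerD2r// invr_ge0 mulr_ge0 ?exprn_ge0//; lra.
Qed.

Lemma expR_near1 (eps : R) : 0 < eps ->
  exists2 eta : R, 0 < eta & forall y, `|y| <= eta -> `|expR y - 1| <= eps.
Proof.
move=> e0; have /cvgrPdist_le/(_ _ e0) := @continuous_expR R 0.
rewrite expR0 => -[/= r r0 rP]; exists (r / 2); first by rewrite divr_gt0.
move=> y yr; rewrite distrC; apply: rP => /=.
rewrite sub0r normrN (le_lt_trans yr)//; lra.
Qed.

Lemma harmonic_unbounded (x : R) :
  exists L, x <= \sum_(1 <= i < L.+1) i%:R^-1.
Proof.
apply: contrapT => /forallNP hx; apply: (@dvg_harmonic R).
apply: nondecreasing_is_cvgn.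
  by apply/nondecreasing_seqP => n; rewrite /series/= big_nat_recr//= lerDl invr_ge0.
exists x => _ [n _ <-]; have /negP := hx n; rewrite -ltNge => /ltW.
by rewrite /series/= big_add1.
Qed.

End RealEstimates.

(** * Exponents along the curve *)

Section Block.
Variables (R : realType) (V : normedModType R) (d : nat).
Variables (al rho a b : R) (g : 'I_d -> R -> R).
Hypotheses (al01 : 0 < al <= 1) (rho0 : 0 < rho) (a0 : 0 < a) (b0 : 0 <= b).
Hypothesis g_bnd : forall i (t : R), 0 <= t <= 1 -> a <= g i t <= b.
Hypothesis g_holder : forall i (s t : R), 0 <= s <= 1 -> 0 <= t <= 1 ->
  `|g i s - g i t| <= rho * `|s - t| `^ al.
Implicit Types (i : 'I_d) (s t c : R) (j k l n q h : nat).

Let al0 : 0 < al. Proof. by case/andP: al01. Qed.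

Definition pw n : R := n%:R `^ al.

Lemma pw_ge0 n : 0 <= pw n. Proof. exact: powR_ge0. Qed.

Lemma le_pw m n : (m <= n)%N -> pw m <= pw n.
Proof. by move=> mn; apply: ge0_ler_powR; rewrite ?nnegrE ?ler_nat// ltW. Qed.

Lemma pw_addn m n : pw (m + n) <= pw m + pw n.
Proof. by rewrite /pw natrD powR_le_addr. Qed.

Lemma pw_muln m n : pw (m * n) = pw m * pw n.
Proof. by rewrite /pw natrM powRM. Qed.

(** By the Hölder condition and subadditivity of [pw], the factors are at most [rho (c / (j N))^al]
    and [(j N)^al]; the step [c / (j N)] is chosen so that [j N] cancels. *)
Lemma main_exponent i c N j k (t tl : R) : 0 < c -> (0 < N)%N -> (0 < j)%N ->
  0 <= t <= 1 -> 0 <= tl <= 1 -> `|t - tl| <= c / (j * N)%:R ->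
  `|(g i t - g i tl) * (pw (j * N + k) - pw k)| <= rho * c `^ al.
Proof.
move=> c0 N0 j0 t01 tl01 ttl.
have jN0 : 0 < (j * N)%:R :> R by rewrite ltr0n muln_gt0 j0.
rewrite normrM [X in _ * X]ger0_norm ?subr_ge0 ?le_pw ?leq_addl//.
have h : pw (j * N + k) - pw k <= pw (j * N) by rewrite lerBlDr pw_addn.
have gg := g_holder i t01 tl01.
have -> : c `^ al = (c / (j * N)%:R) `^ al * pw (j * N).
  by rewrite -powRM ?divr_ge0 ?(ltW c0)// divfK// gt_eqF.
rewrite mulrA ler_pM ?subr_ge0 ?le_pw ?leq_addl// (le_trans gg)//.
by rewrite ler_wpM2l ?(ltW rho0)// ge0_ler_powR ?nnegrE ?divr_ge0// ltW.
Qed.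

(** The first product is the exponent gained by [j N] shifts at [t], the second the exponent lost in
    the right inverse at [tl]. The part [g i tl * pw k] of the latter costs [b * pw q]. *)
Lemma cross_exponent i (K : nat) c N q j l k (t tl : R) : 2 * b <= a * pw K ->
  0 < c -> rho * (c * K%:R) `^ al <= a / 2 ->
  (q <= N)%N -> (k < q)%N -> (0 < j < l)%N ->
  0 <= t <= 1 -> 0 <= tl <= 1 -> `|t - tl| <= (l - j)%:R * (c / (j * N)%:R) ->
  g i t * (pw (l * N + k) - pw ((l - j) * N + k)) -
    g i tl * (pw (l * N + k) - pw k)
  <= - (a / 2 * pw ((l - j) * N)) + b * pw q.
Proof.
move=> Kab c0 Kc qN kq /andP[j0 jl] t01 tl01 ttl.
have kN : (k < N)%N by exact: leq_trans kq qN.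
have N0 : (0 < N)%N by exact: leq_trans kN.
have /andP[gt1 gt2] := g_bnd i t01; have /andP[gl1 gl2] := g_bnd i tl01.
have gt0 : 0 <= g i t by exact: le_trans (ltW a0) gt1.
have lj : (l = l - j + j)%N by rewrite subnK// ltnW.
have kq' : pw k <= pw q by rewrite le_pw// ltnW.
have lk : g i tl * pw k <= b * pw q.
  by rewrite ler_pM ?pw_ge0// (le_trans _ gl1)// ltW.
(* Far nodes: the gain is at most [b * pw (j * N)], hence at most half of [a * pw (l * N)]. *)
have [Kjl|Kjl] := leqP (K * j) l.
  have h1 : pw (l * N + k) - pw ((l - j) * N + k) <= pw (j * N).
    by rewrite lerBlDr [in leLHS]lj mulnDl addnAC addnC pw_addn.
  have h2 : g i t * (pw (l * N + k) - pw ((l - j) * N + k)) <= b * pw (j * N).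
    by rewrite ler_pM// ?subr_ge0 ?le_pw ?leq_add2r ?leq_mul2r ?leq_subr ?orbT.
  have h3 : 2 * b * pw (j * N) <= a * pw (l * N).
    rewrite (le_trans (ler_wpM2r (pw_ge0 _) Kab))// -mulrA ler_wpM2l ?(ltW a0)//.
    by rewrite -pw_muln le_pw// mulnA leq_mul2r Kjl orbT.
  have h4 : a * pw (l * N) <= g i tl * pw (l * N + k).
    by rewrite ler_pM ?pw_ge0 ?le_pw ?leq_addr// ltW.
  have h5 : a / 2 * pw ((l - j) * N) <= a / 2 * pw (l * N).
    by rewrite ler_wpM2l ?divr_ge0 ?(ltW a0)// le_pw// leq_mul2r leq_subr orbT.
  lra.
(* Near nodes, where [l + 1 <= K j]: the two multiples of [pw (l * N + k)] are grouped, with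
   coefficient [g i t - g i tl]. *)
have h1 : pw (l * N + k) <= pw (K * (j * N)).
  rewrite le_pw// mulnA (@leq_trans (l.+1 * N))//; last by rewrite leq_mul2r Kjl orbT.
  by rewrite mulSn addnC leq_add2r ltnW.
have jN0 : 0 < (j * N)%:R :> R by rewrite ltr0n muln_gt0 j0.
have h2 : (g i t - g i tl) * pw (l * N + k) <= a / 2 * pw (l - j).
  rewrite (le_trans (ler_wpM2r (pw_ge0 _) (ler_norm _)))//.
  have gg := g_holder i t01 tl01.
  have gg2 : `|g i t - g i tl| <= rho * ((l - j)%:R * (c / (j * N)%:R)) `^ al.
    rewrite (le_trans gg)// ler_wpM2l ?(ltW rho0)// ge0_ler_powR ?nnegrE ?(ltW al0)//.
    by rewrite !mulr_ge0 ?invr_ge0// ltW.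
  apply: le_trans (ler_pM (normr_ge0 _) (pw_ge0 _) gg2 h1) _.
  rewrite -[leLHS]mulrA /pw -powRM//; last first.
    by rewrite !mulr_ge0 ?invr_ge0// ltW.
  have -> : (l - j)%:R * (c / (j * N)%:R) * (K * (j * N))%:R = c * K%:R * (l - j)%:R :> R.
    by rewrite [(K * _)%:R]natrM; field; rewrite !pnatr_eq0 -!lt0n N0 j0.
  by rewrite powRM ?mulr_ge0 ?(ltW c0)// mulrA ler_wpM2r ?powR_ge0.
have h3 : a / 2 * pw (l - j) <= a / 2 * pw ((l - j) * N).
  by rewrite ler_wpM2l ?divr_ge0 ?(ltW a0)// le_pw// leq_pmulr.
have h4 : a * pw ((l - j) * N) <= g i t * pw ((l - j) * N + k).
  by rewrite ler_pM ?pw_ge0 ?le_pw ?leq_addr// ltW.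
lra.
Qed.

(** * A partition of [0, 1] with harmonic steps *)

Section Nodes.
Variables (c : R) (N : nat).
Hypotheses (c0 : 0 < c) (N0 : (0 < N)%N).

Definition node_sum l : R := \sum_(1 <= m < l) c / (m * N)%:R.

Definition node l : R := Num.min (node_sum l) 1.

Lemma node_sum_ge0 l : 0 <= node_sum l.
Proof. by apply: sumr_ge0 => m _; rewrite divr_ge0// ltW. Qed.

Lemma node01 l : 0 <= node l <= 1.
Proof. by rewrite /node le_min node_sum_ge0 ler01 ge_min lexx orbT. Qed.

Lemma node_sum_cat j l : (0 < j <= l)%N ->
  node_sum l = node_sum j + \sum_(j <= m < l) c / (m * N)%:R.
Proof. by move=> /andP[j0 jl]; rewrite /node_sum (big_cat_nat j0 jl). Qed.

Lemma node_sumB_le j l : (0 < j <= l)%N ->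
  node_sum l - node_sum j <= (l - j)%:R * (c / (j * N)%:R).
Proof.
move=> jl; rewrite (node_sum_cat jl) addrAC subrr add0r.
rewrite mulr_natl -sumr_const_nat ler_sum_nat// => m /andP[jm _].
case/andP: jl => j0 _; rewrite ler_wpM2l ?(ltW c0)//.
rewrite lef_pV2 ?posrE ?ltr0n ?muln_gt0 ?N0 ?j0 ?(leq_trans j0)//.
by rewrite ler_nat leq_mul2r jm orbT.
Qed.

Lemma node_between J (t : R) : 0 <= t -> t <= node_sum J.+2 ->
  exists2 j, (0 < j <= J.+1)%N & node_sum j <= t <= node_sum j.+1.
Proof.
move=> t0; elim: J => [|J IHJ] tJ.
  by exists 1%N => //; rewrite tJ andbT /node_sum big_geq.
have [/IHJ[j /andP[j0 jJ] tj]|/ltW tJ'] := leP t (node_sum J.+2).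
  by exists j => //; rewrite j0 leqW.
by exists J.+2; rewrite ?leqnn// tJ' tJ.
Qed.

(** The steps decrease, so [l - j] of them add up to at most [l - j] times the [j]-th one. As
    [t <= 1], truncation at 1 only moves the node towards [t]. *)
Lemma node_dist j l (t : R) : (0 < j < l)%N -> 0 <= t <= 1 ->
  node_sum j <= t <= node_sum j.+1 ->
  `|t - node l| <= (l - j)%:R * (c / (j * N)%:R).
Proof.
move=> /andP[j0 jl] /andP[t0 t1] /andP[jt tj].
have jl' : (0 < j <= l)%N by rewrite j0 ltnW.
have tl : t <= node l.
  rewrite /node le_min t1 andbT (le_trans tj)// (@node_sum_cat j.+1 l)//.
  by rewrite lerDl sumr_ge0// => m _; rewrite divr_ge0// ltW.
rewrite distrC ger0_norm ?subr_ge0//.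
rewrite (le_trans _ (node_sumB_le jl'))// lerB//.
by rewrite /node ge_min lexx.
Qed.

Lemma node_dist0 j (t : R) : (0 < j)%N -> t <= 1 ->
  node_sum j <= t <= node_sum j.+1 -> `|t - node j| <= c / (j * N)%:R.
Proof.
move=> j0 t1 /andP[jt tj].
have -> : node j = node_sum j by apply/min_idPl/(le_trans jt).
rewrite ger0_norm ?subr_ge0// lerBlDl (le_trans tj)//.
by rewrite (@node_sum_cat j) ?j0 ?leqnSn// big_nat1.
Qed.

Lemma node_sum_unbounded (x : R) : exists L, x <= node_sum L.+2.
Proof.
have [L hL] := harmonic_unbounded (x * N%:R / c).
exists L; rewrite /node_sum.
apply: (@le_trans _ _ (c / N%:R * \sum_(1 <= i < L.+1) i%:R^-1)).
  by rewrite -ler_pdivrMl ?divr_gt0 ?ltr0n// invf_div mulrC mulrA.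
rewrite mulr_sumr [leRHS]big_nat_recr//= -[leLHS]addr0 lerD ?divr_ge0 ?(ltW c0)//.
by apply: ler_sum => m _; rewrite natrM invfM mulrAC mulrA.
Qed.

End Nodes.

(** * One block approximating one target for all parameters *)

(** The factor is the product [w (k+1) * ... * w (k+n)] of the weights with parameter [lam], so this
    is the [n]-th iterate of the shift, on arbitrary sequences. *)
Definition bshift (lam : R) n (x : nat -> V) k : V :=
  expR (lam * (pw (n + k) - pw k)) *: x (n + k)%N.

(** Serves as the l^1 estimate for blocks, for their errors and for finitely supported sequences:
    [q] head entries, a gap up to [N], an inverse-square tail. *)
Lemma sum_head_tail_le (F : nat -> R) (N q L : nat) (dl D : R) :
  (0 < N)%N -> 0 <= dl -> 0 <= D ->
  (forall h, (h < N)%N -> F h <= if (h < q)%N then dl else 0) ->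
  (forall h, (N <= h)%N -> F h <= D / h%:R ^+ 2) ->
  \sum_(0 <= h < L) F h <= q%:R * dl + 2 * D / N%:R.
Proof.
move=> N0 dl0 D0 Fhead Ftail.
(* Counting the head entries by [minn L q] makes the bound inductive in [L]. *)
suff /le_trans : \sum_(0 <= h < L) F h <=
    (minn L q)%:R * dl + D * \sum_(N <= h < L) h%:R ^- 2.
  apply; apply: lerD; first by rewrite ler_wpM2r// ler_nat geq_minr.
  by rewrite mulrAC [leRHS]mulrC ler_wpM2l// sum_invsqr_le.
elim: L => [|L IHL]; first by rewrite !big_geq// min0n mul0r mulr0 addr0.
rewrite big_nat_recr//=.
apply: le_trans (lerD IHL (lexx _)) _.
have [NL|LN] := leqP N L.
  rewrite [in leRHS]big_nat_recr//= mulrDr addrA lerD ?Ftail// lerD2r.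
  by rewrite ler_wpM2r// ler_nat leq_min (leq_trans (geq_minl _ _))//= geq_minr.
rewrite !big_geq ?(ltnW LN)// mulr0 !addr0.
apply: le_trans (lerD (lexx _) (Fhead _ LN)) _.
case: ifPn => Lq; last first.
  rewrite addr0 ler_wpM2r// ler_nat.
  by rewrite leq_min (leq_trans (geq_minl _ _))//= geq_minr.
by rewrite (minn_idPl Lq) (minn_idPl (ltnW Lq)) -[in leRHS]natr1 mulrDl mul1r.
Qed.

(** For [v] supported below [N] the summands of the block have disjoint supports: at [n = l N + k]
    with [k < N] only the [l]-th one contributes, through [v i k]. *)
Definition block_vec c N J (v : 'I_d -> nat -> V) i n : V :=
  if (0 < n %/ N <= J)%N
  then expR (- (g i (node c N (n %/ N)) * (pw n - pw (n %% N)))) *: v i (n %% N)%N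
  else 0.

(** The factor 4 comes from [h <= 2 (h %/ N) N], squared. *)
Lemma tail_bound (C e : R) N h :
  (forall x : R, 1 <= x -> expR (- (a / 2 * x `^ al)) <= C / x ^+ 2) ->
  0 < C -> (0 < N <= h)%N ->
  expR (- (a / 2 * pw (h %/ N * N)) + e) <= 4 * C * expR e / h%:R ^+ 2.
Proof.
move=> CP C0 /andP[N0 Nh]; rewrite expRD [leRHS]mulrAC ler_wpM2r ?expR_ge0//.
have hN0 : (0 < h %/ N * N)%N by rewrite muln_gt0 divn_gt0// Nh.
apply: le_trans (CP _ _) _; first by rewrite ler1n.
have h0 : (0 < h)%N by exact: leq_trans Nh.
rewrite [4 * C]mulrC -mulrA ler_wpM2l ?(ltW C0)//.
rewrite ler_pdivlMr ?exprn_gt0 ?ltr0n// mulrC ler_pdivrMr ?exprn_gt0 ?ltr0n//.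
have -> : 4 = 2 ^+ 2 :> R by rewrite -natrX.
rewrite -exprMn ler_sqr ?nnegrE// -natrM ler_nat.
rewrite [leqLHS](divn_eq h N) mul2n -addnn leq_add2l.
by rewrite (leq_trans (ltnW (ltn_pmod _ N0)))// leq_pmull// divn_gt0.
Qed.

Lemma powR_small (y : R) : 0 < y -> exists2 c : R, 0 < c & c `^ al <= y.
Proof.
move=> y0; exists (y `^ al^-1); first exact: powR_gt0.
by rewrite -powRrM mulVf ?gt_eqF// powRr1// ltW.
Qed.

Lemma pw_unbounded (y : R) : exists K, y <= pw K.
Proof.
have [y0|y0] := leP y 0; first by exists 0%N; rewrite (le_trans y0)// pw_ge0.
exists (Num.trunc (y `^ al^-1)).+1.
have yE : y = (y `^ al^-1) `^ al by rewrite -powRrM mulVf ?gt_eqF// powRr1// ltW.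
rewrite [leLHS]yE; apply: ge0_ler_powR; rewrite ?nnegrE ?powR_ge0 ?(ltW al0)//.
exact/ltW/truncnS_gt.
Qed.

Lemma finite_norm_bound (v : 'I_d -> nat -> V) q :
  (forall i k, (q <= k)%N -> v i k = 0) ->
  exists2 A : R, 0 < A & forall i k, `|v i k| <= A.
Proof.
move=> vq; exists (1 + \sum_i \sum_(k < q) `|v i k|).
  by rewrite ltr_pwDl// sumr_ge0// => i _; apply: sumr_ge0.
move=> i k; have [/vq ->|kq] := leqP q k.
  by rewrite normr0 addr_ge0// sumr_ge0// => j _; apply: sumr_ge0.
rewrite (bigD1 i)//= (bigD1 (Ordinal kq))//=.
set s1 := \sum_(_ | _) _; set s2 := \sum_(_ | _) _;
have s10 : 0 <= s1 by apply: sumr_ge0.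
have s20 : 0 <= s2 by apply: sumr_ge0 => j _; apply: sumr_ge0.
by lra.
Qed.

(** The times lie in [[M, M')] for the sake of gluing: by then blocks supported below [M] are
    shifted away, and blocks starting at [M'] or later can be made small in advance. *)
Lemma exists_block (v : 'I_d -> nat -> V) q (eps : R) M :
  (forall i k, (q <= k)%N -> v i k = 0) -> 0 < eps ->
  exists (u : 'I_d -> nat -> V) M', [/\ (M < M')%N,
    forall i n, (n < M)%N -> u i n = 0,
    forall i n, (M' <= n)%N -> u i n = 0,
    forall i L, \sum_(0 <= n < L) `|u i n| <= eps &
    forall t : R, 0 <= t <= 1 -> exists2 n, (M <= n < M')%N &
      forall i L, \sum_(0 <= k < L) `|bshift (g i t) n (u i) k - v i k| <= eps].
Proof.
move=> vq eps0.
have [A A0 vA] := finite_norm_bound vq.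
(* Order of choice: [K] separates near from far nodes, [c] controls both exponents, [N] the tails,
   and [J] makes the nodes reach 1. *)
have [K KP] : exists K, 2 * b <= a * pw K.
  have [K KP] := pw_unbounded (2 * b / a).
  by exists K; rewrite [leRHS]mulrC -ler_pdivrMr.
have q0 : 0 < q.+1%:R :> R by rewrite ltr0n.
have e1 : 0 < eps / 2 / (q.+1%:R * A) by rewrite !divr_gt0// mulr_gt0.
have [eta eta0 etaP] := expR_near1 e1.
have K0 : 0 < 1 + pw K by rewrite ltr_pwDl// pw_ge0.
have [c c0 cP] : exists2 c : R, 0 < c &
    rho * c `^ al <= eta /\ rho * (c * K%:R) `^ al <= a / 2.
  (* The summand 1 in [1 + pw K] avoids a division by zero. *)
  have y0 : 0 < Num.min (eta / rho) (a / 2 / rho / (1 + pw K)).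
    by rewrite lt_min; apply/andP; split; rewrite !divr_gt0.
  have [c c0] := powR_small y0; rewrite le_min => /andP[c1 c2].
  exists c => //; split; first by rewrite mulrC -ler_pdivlMr.
  rewrite powRM ?(ltW c0)// mulrC -ler_pdivlMr//.
  apply: (@le_trans _ _ (c `^ al * (1 + pw K))); last by rewrite -ler_pdivlMr.
  by rewrite ler_wpM2l ?powR_ge0// lerDr.
case: cP => cP1 cP2.
have a20 : 0 < a / 2 by rewrite divr_gt0.
have [C C0 CP] := expRN_powR_le a20 al0.
(* [E] is the cost of the term [b * pw q] in the exponents, [4 * C] comes from [tail_bound], and [A]
   bounds [v]. *)
pose E := expR (b * pw q); pose D := 4 * C * E * A.
have D0 : 0 < D by rewrite !mulr_gt0// expR_gt0.
have [N [N0 MN qN DN]] : exists N, [/\ (0 < N)%N, (M <= N)%N, (q <= N)%N &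
    2 * D / N%:R <= eps / 2].
  have eps20 : 0 < eps / 2 by rewrite divr_gt0.
  exists (M + q + (Num.trunc (2 * D / (eps / 2))).+1)%N; split.
  - by rewrite addnS.
  - by rewrite -addnA leq_addr.
  - by rewrite addnAC leq_addl.
  rewrite ler_pdivrMr ?ltr0n ?addnS// [leRHS]mulrC -ler_pdivrMr//.
  by rewrite (le_trans (ltW (truncnS_gt _)))// ler_nat ltnS leq_addl.
have [J JP] := node_sum_unbounded c0 N0 1.
pose u := block_vec c N J.+1 v.
have normE i (x : R) k : `|expR x *: v i k| = expR x * `|v i k|.
  by rewrite normrZ gtr0_norm// expR_gt0.
have tailE i h (x : R) k : (N <= h)%N ->
    ((k < q)%N -> x <= - (a / 2 * pw (h %/ N * N)) + b * pw q) ->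
    `|expR x *: v i k| <= D / h%:R ^+ 2.
  move=> Nh xP; have [/vq ->|/xP xk] := leqP q k.
    by rewrite scaler0 normr0 divr_ge0 ?exprn_ge0// ltW.
  rewrite normE /D [leRHS]mulrAC ler_pM ?expR_ge0//.
  have Nh' : (0 < N <= h)%N by rewrite N0.
  by apply: le_trans (tail_bound _ CP C0 Nh'); rewrite ler_expR.
exists u, (J.+2 * N)%N; split.
- by rewrite (leq_ltn_trans MN)// ltn_Pmull.
- by move=> i n nM; rewrite /u /block_vec divn_small// (leq_trans nM).
- move=> i n Mn; rewrite /u /block_vec; case: ifP => // /andP[_].
  by rewrite -ltnS ltn_divLR// ltnNge Mn.
- move=> i L.
  (* There is no head: the block vanishes below [N]. *)
  apply: le_trans (sum_head_tail_le (q := 0) (dl := 0) (D := D) L N0 _ _ _ _) _.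
  + by [].
  + exact: ltW.
  + by move=> h hN; rewrite /u /block_vec divn_small//= normr0.
  + move=> h Nh; rewrite /u /block_vec; case: ifP => [hJ|_]; last first.
      by rewrite normr0 divr_ge0 ?exprn_ge0// ltW.
    apply: tailE => // kq.
    have /andP[g1 g2] := g_bnd i (node01 N c0 (h %/ N)).
    set G := g i _ in g1 g2 *.
    have h1 : a * pw (h %/ N * N) <= G * pw h.
      by rewrite ler_pM ?pw_ge0 ?(ltW a0)// le_pw// leq_divM.
    have h2 : G * pw (h %% N) <= b * pw q.
      by rewrite ler_pM ?pw_ge0 ?le_pw// ?(ltnW kq)// (le_trans _ g1)// ltW.
    have h3 : a / 2 * pw (h %/ N * N) <= a * pw (h %/ N * N).
      by rewrite ler_wpM2r ?pw_ge0//; lra.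
    by rewrite mulrBr opprB addrC; lra.
  + by rewrite mul0r add0r (le_trans DN)//; lra.
move=> t t01; have /andP[t0 t1] := t01.
have [j /andP[j0 jJ] tj] := node_between t0 (le_trans t1 JP).
exists (j * N)%N.
  by rewrite (leq_trans MN) ?leq_pmull//= ltn_mul2r N0.
move=> i L.
pose dl := eps / 2 / q.+1%:R.
have dl0 : 0 < dl by rewrite !divr_gt0.
apply: le_trans (sum_head_tail_le (q := q) (dl := dl) (D := D) L N0 _ _ _ _) _.
- exact: ltW.
- exact: ltW.
(* Coordinates [h < N] come from the summand [l = j], so the difference is [(expR y - 1) *: v i h]
   with [y] bounded by [main_exponent]. *)
- move=> h hN; rewrite /bshift /u /block_vec divnMDl// modnMDl.
  rewrite divn_small// addn0 modn_small// j0 jJ/= scalerA -expRD.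
  rewrite -[X in _ - X]scale1r -scalerBl normrZ.
  case: ltnP => hq; last by rewrite vq// normr0 mulr0.
  have -> : dl = eps / 2 / (q.+1%:R * A) * A by rewrite /dl; field; rewrite !gt_eqF.
  rewrite ler_pM// etaP// -mulrBl.
  apply: le_trans cP1; apply: main_exponent => //; first exact: node01.
  exact: node_dist0.
(* Coordinates [h >= N] come from the summand [l = j + h %/ N > j], if it exists. *)
- move=> h Nh; rewrite (vq i h) ?(leq_trans qN)// subr0.
  rewrite /bshift /u /block_vec divnMDl// modnMDl.
  case: ifP => [/andP[_ hJ]|_]; last first.
    by rewrite scaler0 normr0 divr_ge0 ?exprn_ge0// ltW.
  rewrite scalerA -expRD; apply: tailE => // kq.
  have r0 : (0 < h %/ N)%N by rewrite divn_gt0.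
  have jl : (0 < j < j + h %/ N)%N by rewrite j0/= -[ltnLHS]addn0 ltn_add2l.
  have := cross_exponent i KP c0 cP2 qN kq jl t01 (node01 N c0 _)
    (node_dist c0 N0 jl t01 tj).
  by rewrite addKn -divn_eq mulnDl -addnA -divn_eq.
- have : q%:R * dl <= eps / 2.
    rewrite /dl mulrCA ler_piMr ?divr_ge0 ?(ltW eps0)//.
    by rewrite ler_pdivrMr// mul1r ler_nat.
  by lra.
Qed.


(** * Gluing blocks into one vector *)

Lemma sum_half_powers_le m B : \sum_(m <= l < B) (2^-1 : R) ^+ l <= 2 * 2^-1 ^+ m.
Proof.
have [Bm|/ltnW mB] := leqP B m; first by rewrite big_geq// mulr_ge0// exprn_ge0.
suff -> : \sum_(m <= l < B) (2^-1 : R) ^+ l = 2 * 2^-1 ^+ m - 2 * 2^-1 ^+ B.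
  by rewrite gerBl mulr_ge0// exprn_ge0.
rewrite -(subnKC mB); elim: (B - m)%N => [|r IHr].
  by rewrite addn0 subrr big_geq.
rewrite addnS big_nat_recr ?leq_addr//= IHr exprS.
by rewrite mulrA divff// mul1r; ring.
Qed.

Lemma bshift_sum (I : Type) (r : seq I) (P : pred I) (lam : R) n
    (F : I -> nat -> V) k :
  bshift lam n (fun h => \sum_(i <- r | P i) F i h) k =
  \sum_(i <- r | P i) bshift lam n (F i) k.
Proof. by rewrite /bshift scaler_sumr. Qed.

(** Subadditivity of [pw] bounds every factor of the [n]-th iterate by [expR (b * pw n)], uniformly
    in [i] and [t]. *)
Lemma sum_bshift_le i (t : R) n (x : nat -> V) (B : R) : 0 <= t <= 1 ->
  (forall L, \sum_(0 <= k < L) `|x k| <= B) ->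
  forall L, \sum_(0 <= k < L) `|bshift (g i t) n x k| <= expR (b * pw n) * B.
Proof.
move=> t01 xB L; have /andP[g1 g2] := g_bnd i t01.
apply: (@le_trans _ _ (expR (b * pw n) * \sum_(0 <= k < L) `|x (n + k)%N|)).
  rewrite mulr_sumr; apply: ler_sum => k _.
  rewrite /bshift normrZ gtr0_norm ?expR_gt0// ler_wpM2r// ler_expR.
  apply: ler_pM => //; first exact: le_trans (ltW a0) g1.
    by rewrite subr_ge0 le_pw// leq_addl.
  by rewrite lerBlDr pw_addn.
rewrite ler_wpM2l ?expR_ge0// (le_trans _ (xB (n + L)%N))//.
rewrite [leRHS](@big_cat_nat _ _ _ n) ?leq_addr//= -[leLHS]add0r lerD ?sumr_ge0//.
have -> : \sum_(n <= k < n + L) `|x k| = \sum_(0 <= k < L) `|x (k + n)%N|.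
  by rewrite -{1}[n]add0n big_addn addKn.
by under [leRHS]eq_bigr do rewrite addnC.
Qed.

Lemma exists_common_vector (y : nat -> 'I_d -> nat -> V) (q : nat -> nat) :
  (forall m i k, (q m <= k)%N -> y m i k = 0) ->
  exists u : 'I_d -> nat -> V,
    (forall i L, \sum_(0 <= n < L) `|u i n| <= 2) /\
    forall m (t : R), 0 <= t <= 1 -> exists n, forall i L,
      \sum_(0 <= k < L) `|bshift (g i t) n (u i) k - y m i k| <= 2 * 2^-1 ^+ m.
Proof.
(* The factor [expR (- (b * pw M))] compensates the growth under at most [M] shifts of a block
   starting at [M]. *)
move=> yq; pose e m M : R := 2^-1 ^+ m * expR (- (b * pw M)).
have e0 m M : 0 < e m M by rewrite mulr_gt0 ?exprn_gt0 ?expR_gt0.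
have /choice[F FP] : forall z : nat * nat, exists w : ('I_d -> nat -> V) * nat,
  [/\ (z.2 < w.2)%N, forall i n, (n < z.2)%N -> w.1 i n = 0,
    forall i n, (w.2 <= n)%N -> w.1 i n = 0,
    forall i L, \sum_(0 <= n < L) `|w.1 i n| <= e z.1 z.2 &
    forall t : R, 0 <= t <= 1 -> exists2 n, (z.2 <= n < w.2)%N &
      forall i L, \sum_(0 <= k < L) `|bshift (g i t) n (w.1 i) k - y z.1 i k|
        <= e z.1 z.2].
  move=> [m M] /=; have [u [M' uP]] := exists_block M (yq m) (e0 m M).
  by exists (u, M').
(* Each block starts where the preceding one ends. *)
pose Ms := fix Ms m := if m is m'.+1 then (F (m', Ms m')).2 else 0%N.
pose U m := (F (m, Ms m)).1.
have MsS m : (Ms m < Ms m.+1)%N by have [] := FP (m, Ms m).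
have Ms_le l m : (l <= m)%N -> (Ms l <= Ms m)%N.
  elim: m => [|m IHm]; first by rewrite leqn0 => /eqP ->.
  by rewrite leq_eqVlt => /predU1P[->//|/IHm/leq_trans]; apply; exact/ltnW.
have Ms_ge m : (m <= Ms m)%N by elim: m => // m /leq_ltn_trans; apply.
have Ulow m i n : (n < Ms m)%N -> U m i n = 0.
  by have [_ + _ _ _] := FP (m, Ms m); apply.
have Uhigh m i n : (Ms m.+1 <= n)%N -> U m i n = 0.
  by have [_ _ + _ _] := FP (m, Ms m); apply.
have Usum m i L : \sum_(0 <= n < L) `|U m i n| <= e m (Ms m).
  by have [_ _ _ + _] := FP (m, Ms m); apply.
(* A finite sum suffices: block [m] starts at [Ms m >= m], so blocks with [m > n] vanish at [n]. *)
pose u i n := \sum_(0 <= m < n.+1) U m i n.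
have uE i n B : (n < B)%N -> u i n = \sum_(0 <= m < B) U m i n.
  move=> nB; rewrite [RHS](@big_cat_nat _ _ _ n.+1)//= [X in _ + X]big_nat.
  rewrite [X in _ + X]big1 ?addr0// => m /andP[nm _].
  by rewrite Ulow// (leq_trans nm).
have e_le m n : (n <= Ms m)%N -> expR (b * pw n) * e m (Ms m) <= 2^-1 ^+ m.
  move=> nM; rewrite /e mulrCA -expRD ler_piMr ?exprn_ge0// expR_le1.
  by rewrite subr_le0 ler_wpM2l// le_pw.
have e_le0 m : e m (Ms m) <= 2^-1 ^+ m.
  rewrite (le_trans _ (e_le m 0%N _))// ler_peMl ?(ltW (e0 _ _))//.
  by rewrite -expR0 ler_expR mulr_ge0 ?pw_ge0.
exists u; split.
  move=> i L; apply: (@le_trans _ _ (\sum_(0 <= m < L) \sum_(0 <= n < L) `|U m i n|)).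
    rewrite exchange_big/= ler_sum_nat// => n /andP[_ nL].
    by rewrite (uE i n L)// ler_norm_sum.
  apply: (@le_trans _ _ (\sum_(0 <= m < L) 2^-1 ^+ m)).
    by apply: ler_sum => m _; rewrite (le_trans (Usum _ _ _)).
  by rewrite (le_trans (sum_half_powers_le 0 L))// expr0 mulr1.
move=> m t t01; have [_ _ _ _ /(_ t t01)] := FP (m, Ms m).
move=> [n /= /andP[Mn nM] nP]; exists n => i L.
(* The share of block [l] in the error; the target is charged to block [m]. *)
pose z l k := bshift (g i t) n (U l i) k - (if l == m then y m i k else 0).
pose B := (n + L + m).+1.
have uz k : (k < L)%N -> bshift (g i t) n (u i) k - y m i k = \sum_(0 <= l < B) z l k.
  move=> kL; rewrite sumrB -bshift_sum; congr (_ - _).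
    rewrite /bshift (uE i _ B)// /B ltnS -addnA leq_add2l.
    by rewrite (leq_trans (ltnW kL)) ?leq_addr.
  rewrite -big_mkcond/= big_nat1_eq /B.
  by rewrite ltnS leq_addl.
apply: (@le_trans _ _ (\sum_(0 <= l < B) \sum_(0 <= k < L) `|z l k|)).
  rewrite exchange_big/= ler_sum_nat// => k /andP[_ kL].
  by rewrite uz// ler_norm_sum.
apply: (@le_trans _ _ (\sum_(m <= l < B) 2^-1 ^+ l)); last exact: sum_half_powers_le.
have mB : (m <= B)%N by rewrite /B leqW// leq_addl.
(* Blocks [l < m] are killed, as they end by [Ms m <= n]. *)
rewrite (@big_cat_nat _ _ _ m)//= [X in X + _]big_nat [X in X + _]big1 ?add0r; last first.
  move=> l /andP[_ lm]; rewrite big1// => k _.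
  rewrite /z ltn_eqF// subr0 /bshift Uhigh ?scaler0 ?normr0//.
  by rewrite (leq_trans (Ms_le _ _ lm))// (leq_trans Mn)// leq_addr.
rewrite ler_sum_nat// => l /andP[ml _]; rewrite /z.
move: ml; rewrite leq_eqVlt => /predU1P[<-|ml].
  by rewrite eqxx (le_trans (nP i L)).
(* Blocks [l > m] stay small, as [n < Ms m.+1 <= Ms l]. *)
rewrite gtn_eqF//; under eq_bigr do rewrite subr0.
rewrite (le_trans (sum_bshift_le i n t01 (Usum l i) L))// e_le//.
exact: leq_trans (ltnW nM) (Ms_le m.+1 l ml).
Qed.

End Block.

(** * Comparison of [X] with l^1, and truncation *)

Section SequenceNorm.
Variables (R : realType) (V : normedModType R) (X : seq_space R).
Implicit Types (x : nat -> V) (C e : R).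

Lemma pow_sum_l1 (p : R) x C : 1 <= p ->
  (forall L, \sum_(0 <= n < L) `|x n| <= C) -> (pow_sum p x <= (C `^ p)%:E)%E.
Proof.
move=> p1 xC; apply: lime_le.
  by apply: is_cvg_nneseries => n _ _; rewrite lee_fin powR_ge0.
near=> L; rewrite sumEFin lee_fin (le_trans (sum_powR_le _ p1 _))//.
have p0 : 0 <= p by rewrite (le_trans _ p1).
have s0 : 0 <= \sum_(0 <= n < L) `|x n| by apply: sumr_ge0.
by apply: ge0_ler_powR => //; rewrite nnegrE// (le_trans s0).
Unshelve. all: by end_near.
Qed.

Lemma in_space_l1 x C : (forall L, \sum_(0 <= n < L) `|x n| <= C) -> in_space X x.
Proof.
move=> xC; rewrite /in_space; case: X => [|p p1]; last first.
  by rewrite (le_lt_trans (pow_sum_l1 p1 xC))// ltry.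
apply/norm_cvg0P/cvg_series_cvg_0/nondecreasing_is_cvgn.
  by apply/nondecreasing_seqP => n; rewrite /series/= big_nat_recr//= lerDl.
by exists C => _ [n _ <-]; exact: xC.
Qed.

Lemma space_norm_l1 x C : (forall L, \sum_(0 <= n < L) `|x n| <= C) ->
  space_norm X x <= C.
Proof.
move=> xC; have C0 : 0 <= C by have := xC 0%N; rewrite big_geq.
rewrite /space_norm; case: X => [|p p1].
  apply: ge_sup; first by exists `|x 0%N|, 0%N.
  move=> _ [n _ <-]; rewrite (le_trans _ (xC n.+1))// big_nat_recr//= lerDr.
  by rewrite sumr_ge0.
have p0 : 0 < p by exact: lt_le_trans p1.
have S0 : (0 <= pow_sum p x)%E.
  by apply: nneseries_ge0 => n _ _; rewrite lee_fin powR_ge0.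
have SC := pow_sum_l1 p1 xC.
rewrite -[leRHS](powRr1 C0) -(@divff _ p) ?gt_eqF// powRrM.
apply: ge0_ler_powR; rewrite ?nnegrE ?invr_ge0 ?(ltW p0) ?fine_ge0 ?powR_ge0//.
by rewrite -lee_fin fineK// ge0_fin_numE// (le_lt_trans SC)// ltry.
Qed.

Lemma in_space_le x (y : nat -> V) : (forall n, `|y n| <= `|x n|) ->
  in_space X x -> in_space X y.
Proof.
move=> yx; rewrite /in_space; case: X => [x0|p p1]; last first.
  apply: le_lt_trans; apply: lee_nneseries => n _; first by rewrite lee_fin powR_ge0.
  by rewrite lee_fin ge0_ler_powR ?nnegrE// (le_trans _ p1).
apply/cvgr0Pnorm_le => e e0; near=> n.
by rewrite (le_trans (yx n))//; near: n; exact: cvgr0_norm_le.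
Unshelve. all: by end_near.
Qed.

(** In [c_0] the entries are eventually small; in [l_p] the [p]-th power of the norm of the
    remainder is a tail of a convergent series. *)
Lemma space_norm_tail x e : in_space X x -> 0 < e ->
  exists N, space_norm X (fun n => if (n < N)%N then 0 else x n) <= e.
Proof.
rewrite /in_space /space_norm; case: X => [x0|p p1 xX] e0.
  have [N _ Ne] := cvgr0_norm_le _ x0 _ e0.
  exists N; apply: ge_sup; first by exists `|if (0 < N)%N then 0 else x 0%N|, 0%N.
  move=> _ [n _ <-]; case: ltnP => nN; first by rewrite normr0 ltW.
  exact: Ne.
have p0 : 0 < p by exact: lt_le_trans p1.
have x0 n : (0 <= (`|x n| `^ p)%:E)%E by rewrite lee_fin powR_ge0.
have := nneseries_tail_cvg xX (fun k _ => x0 k).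
have ep0 : 0 < e `^ p by exact: powR_gt0.
move=> /fine_cvgP[_ /cvgr0_norm_le/(_ _ ep0)[N _ /(_ N (leqnn N))/= NP]].
exists N; set S := pow_sum _ _.
have SE : S = (\sum_(N <= k <oo) (`|x k| `^ p)%:E)%E.
  rewrite /S /pow_sum (nneseries_split 0 N); last first.
    by move=> k _; rewrite lee_fin powR_ge0.
  rewrite add0n big_nat big1 ?add0e => [|k /andP[_ kN]]; last first.
    by rewrite kN normr0 powR0 ?gt_eqF.
  congr (limn _); apply/funext => n; apply: eq_big_nat => k /andP[Nk _].
  by rewrite ltnNge Nk.
have S0 : 0 <= fine S by rewrite fine_ge0// SE nneseries_ge0.
rewrite -[leRHS](powRr1 (ltW e0)) -(@divff _ p) ?gt_eqF// powRrM.
apply: ge0_ler_powR; rewrite ?nnegrE ?invr_ge0 ?(ltW p0) ?powR_ge0//.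
by rewrite SE (le_trans (ler_norm _)).
Qed.

End SequenceNorm.

(** * Separability of the scalars *)

Section Scalars.
Variable R : realType.

Lemma scalars_separable (K : scalar_field) : exists e : nat -> scalars R K,
  forall (x : scalars R K) (eps : R), 0 < eps -> exists n, `|x - e n| <= eps.
Proof.
have rat_near (x eps : R) : 0 < eps -> exists r : rat, `|x - ratr r| <= eps.
  move=> e0; have [|r] := @rat_in_itvoo R (x - eps) (x + eps); first by lra.
  by rewrite in_itv/= => /andP[r1 r2]; exists r; rewrite ler_norml; lra.
case: K => /=.
  exists (fun n => ratr (odflt 0 (unpickle n))) => x eps /(rat_near x)[r rP].
  by exists (pickle r); rewrite pickleK.
exists (fun n => let z : rat * rat := odflt (0, 0) (unpickle n) in
  (ratr z.1 +i* ratr z.2)%C : Rcomplex R).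
move=> [x y] eps e0; have e20 : 0 < eps / 2 by rewrite divr_gt0.
have [r rP] := rat_near x _ e20; have [s sP] := rat_near y _ e20.
exists (pickle (r, s)); rewrite pickleK/= /Num.norm/= /Normc.normc/=.
have sq_le (u : R) : `|u| <= eps / 2 -> u ^+ 2 <= (eps / 2) ^+ 2.
  by move=> ue; rewrite -real_normK ?num_real// ler_sqr ?nnegrE// ltW.
rewrite -[leRHS](gtr0_norm e0) -sqrtr_sqr ler_wsqrtr//.
rewrite (le_trans (lerD (sq_le _ rP) (sq_le _ sP)))//.
have : 0 <= eps ^+ 2 by exact: sqr_ge0.
by rewrite expr_div_n; lra.
Qed.

End Scalars.

(** * Iterates of one weighted shift *)

Section IteratedShift.
Variables (R : realType) (V : normedModType R) (X : seq_space R).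
Variables (al lam : R) (w : nat -> R).
Hypotheses (al01 : 0 < al <= 1) (lam0 : 0 < lam).
Hypothesis w0 : forall n, (0 < n)%N -> 0 < w n.
Hypothesis wE : forall n, (0 < n)%N ->
  \prod_(1 <= k < n.+1) w k = expR (lam * n%:R `^ al).

Lemma weightE n : w n.+1 = expR (lam * (pw al n.+1 - pw al n)).
Proof.
have wE0 m : \prod_(1 <= k < m.+1) w k = expR (lam * pw al m).
  case: m => [|m]; last exact: wE.
  rewrite big_geq// /pw powR0 ?mulr0 ?expR0// gt_eqF//.
  by case/andP: al01.
have := wE0 n.+1; rewrite big_nat_recr//= wE0 => wn.
by rewrite mulrBr expRD expRN -wn mulrAC divff ?mul1r// gt_eqF ?expR_gt0.
Qed.

(** The exponents of successive weights telescope. Since [al <= 1] the weights are bounded, so the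
    default value in [wshift] never occurs. *)
Lemma iter_wshiftE n (x : seqsp V X) k :
  iter n (wshift w) x k = bshift al lam n x k.
Proof.
elim: n k => [|n IHn] k.
  by rewrite /bshift add0n subrr mulr0 expR0 scale1r.
rewrite iterS (wshiftE _ (wshift_weight_bound al01 lam0 w0 wE)) IHn /bshift.
rewrite scalerA weightE -expRD -mulrDr addSnnS.
by congr (expR (_ * _) *: _); rewrite addrC addrA subrK.
Qed.

End IteratedShift.

(** * The product topology, and bounds along the curve *)

(** Points of [S] within [1 / (j + 1)] of [y] form a sequence converging in each coordinate, hence
    in the product topology, so it enters [O]. *)
Lemma ptws_dense_hit (R : realType) (Y : normedModType R) (d : nat)
    (O : set {ptws 'I_d -> Y}) (y : 'I_d -> Y) (S : set ('I_d -> Y)) :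
  open O -> O y ->
  (forall eps : R, 0 < eps -> exists2 z, S z & forall i, `|y i - z i| <= eps) ->
  O `&` S !=set0.
Proof.
move=> Oo Oy Sy.
have /choice[z zP] : forall j : nat, exists z,
    S z /\ forall i, `|y i - z i| <= j.+1%:R^-1.
  by move=> j; have [|z Sz zP] := Sy j.+1%:R^-1; [rewrite invr_gt0|exists z].
have zy : (z : nat -> {ptws 'I_d -> Y}) @ \oo --> (y : {ptws 'I_d -> Y}).
  apply/cvg_sup => i W [V] [[U oU <-] yU VW].
  apply: (filterS VW).
  have zi : (fun j => z j i) @ \oo --> y i.
    apply/cvgrPdist_le => e e0; near=> j.
    rewrite (le_trans (proj2 (zP j) i))//.
    by near: j; apply: filterS (near_infty_natSinv_lt (PosNum e0)) => k /ltW.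
  apply: zi; exact: open_nbhs_nbhs.
have [j _ jO] : \forall j \near \oo, O (z j) by apply: zy; exact: open_nbhs_nbhs.
by exists (z j); split; [exact: jO j (leqnn j)|have [] := zP j].
Unshelve. all: by end_near.
Qed.

Lemma holder_bounds (R : realType) (d : nat) (g : 'I_d -> R -> R) (rho al : R) :
  0 < rho -> 0 < al ->
  (forall i (s t : R), 0 <= s <= 1 -> 0 <= t <= 1 ->
    `|g i s - g i t| <= rho * `|s - t| `^ al) ->
  (forall i (t : R), 0 <= t <= 1 -> 0 < g i t) ->
  exists a b : R, [/\ 0 < a, 0 <= b &
    forall i (t : R), 0 <= t <= 1 -> a <= g i t <= b].
Proof.
move=> rho0 al0 gH g0.
have /choice[m mP] : forall i, exists m : R,
    0 < m /\ forall t : R, 0 <= t <= 1 -> m <= g i t.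
  (* Each coordinate is continuous by the Hölder condition, so it attains a positive minimum. *)
  move=> i; have [||c c01 cP] := @EVT_min R (g i) 0 1; first exact: ler01.
    apply/subspace_continuousP => x /=; rewrite in_itv/= => x01.
    apply/cvgrPdist_le => e e0.
    pose r := (e / rho) `^ al^-1.
    have r0 : 0 < r by rewrite powR_gt0// divr_gt0.
    near=> s.
    have s01 : 0 <= s <= 1.
      have : `[0, 1]%classic s by near: s; exact: withinT.
      by rewrite /= in_itv.
    rewrite (le_trans (gH _ _ _ x01 s01))// mulrC -ler_pdivlMr//.
    have -> : e / rho = r `^ al.
      by rewrite /r -powRrM mulVf ?gt_eqF// powRr1// divr_ge0// ltW.
    apply: ge0_ler_powR; rewrite ?nnegrE ?(ltW al0) ?(ltW r0)//.
    have : ball x r s by near: s; apply: cvg_within; exact: nbhsx_ballx.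
    by move/ltW.
  move: c01; rewrite in_itv/= => c01.
  exists (g i c); split; first exact: g0.
  by move=> t t01; apply: cP; rewrite in_itv.
have m0 i : 0 < m i by have [] := mP i.
(* The first witness is below every [m i], and its summand 1 covers [d = 0]. The second works since
   [t] is at distance at most 1 from 0. *)
exists (1 + \sum_i (m i)^-1)^-1, (rho + \sum_i `|g i 0|).
have s0 : 0 < 1 + \sum_i (m i)^-1.
  by rewrite ltr_pwDl// sumr_ge0// => i _; rewrite invr_ge0 ltW.
split; first by rewrite invr_gt0.
  by rewrite addr_ge0 ?(ltW rho0)// sumr_ge0.
move=> i t t01; apply/andP; split.
  have [_ /(_ t t01)] := mP i; apply: le_trans.
  rewrite -[leRHS]invrK lef_pV2 ?posrE ?invr_gt0//.
  rewrite (bigD1 i)//= addrCA lerDl addr_ge0// sumr_ge0// => j _.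
  by rewrite invr_ge0 ltW.
have z01 : 0 <= (0 : R) <= 1 by rewrite lexx ler01.
have gt0 : `|g i t - g i 0| <= rho.
  rewrite (le_trans (gH _ _ _ t01 z01))// ler_piMr ?(ltW rho0)// subr0.
  have /andP[t0 t1] := t01; rewrite [leRHS](_ : 1 = 1 `^ al); last by rewrite powR1.
  by apply: ge0_ler_powR; rewrite ?nnegrE ?(ltW al0)// ger0_norm.
rewrite -[leLHS](subrK (g i 0)).
apply: lerD; first exact: le_trans (ler_norm _) gt0.
by rewrite (bigD1 i)//= (le_trans (ler_norm _))// lerDl sumr_ge0.
Unshelve. all: by end_near.
Qed.

Lemma row_entry_norm_le (R : realType) (d : nat) (x : 'rV[R]_d) i :
  `|x ord0 i| <= `|x|.
Proof.
rewrite -[leRHS]/(mx_norm x) mx_normrE.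
exact: (le_bigmax _ (fun ij => `|x ij.1 ij.2|) (ord0, i)).
Qed.

Lemma iter_prod_op (d : nat) (Y : topologicalType) (T : 'I_d -> Y -> Y)
    (u : {ptws 'I_d -> Y}) n i :
  iter n (prod_op T) u i = iter n (T i) (u i).
Proof. by elim: n => //= n <-. Qed.

(** * Countably many finitely supported targets, dense in the product *)

Section Targets.
Variables (R : realType) (V : normedModType R) (X : seq_space R) (d : nat).
Variable e : nat -> V.
Hypothesis e_dense : forall (x : V) (eps : R), 0 < eps -> exists n, `|x - e n| <= eps.

(** Lists of indices into [e] form a countable type, so that the targets can be enumerated through
    [unpickle]. *)
Definition target (s : {ffun 'I_d -> seq nat}) (i : 'I_d) (k : nat) : V :=
  if (k < size (s i))%N then e (nth 0%N (s i) k) else 0.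

Lemma target_support (s : {ffun 'I_d -> seq nat}) i k :
  (\max_i size (s i) <= k)%N -> target s i k = 0.
Proof.
move=> sk; rewrite /target ifF// ltnNge (leq_trans _ sk)//.
exact: (@leq_bigmax _ (fun i => size (s i)) i).
Qed.

Lemma target_in_space s i : in_space X (target s i).
Proof.
have q0 := @target_support s i; set q := (\max_i _)%N in q0.
apply: (@in_space_l1 _ _ _ _
  (q%:R * (\sum_(k < q) `|target s i k|) + 2 * 0 / q.+1%:R)).
move=> L; apply: sum_head_tail_le => //; first exact: sumr_ge0.
  move=> h _; case: ltnP => hq; last by rewrite q0// normr0.
  by rewrite (bigD1 (Ordinal hq))//= lerDl sumr_ge0.
by move=> h qh; rewrite q0 ?(ltnW qh)// normr0 mul0r.
Qed.

Lemma seqsp_norm_valB (x y : seqsp V X) (z : nat -> V) : in_space X z ->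
  `|x - y| <= space_norm X (fun k => x k - z k) + space_norm X (fun k => y k - z k).
Proof.
move=> zX.
have BzX (v : seqsp V X) : in_space X (fun k => v k - z k).
  have -> : (fun k => v k - z k) = -1 *: z + v.
    by apply/funext => k; rewrite scaleN1r addrC.
  have [_ lin] := @in_space_submod R V X.
  by have /asboolW := lin (-1) _ _ (asboolT zX) (asboolT (seqspP v)).
have NyX : in_space X (-1 *: (fun k => y k - z k)).
  have [S0 lin] := @in_space_submod R V X.
  by have /asboolW := lin (-1) _ _ (asboolT (BzX y)) S0; rewrite addr0.
have -> : `|x - y| =
    space_norm X ((fun k => x k - z k) + -1 *: (fun k => y k - z k)).
  congr (space_norm X _); rewrite scaleN1r; apply/funext => k.
  rewrite -[RHS]/((x k - z k) - (y k - z k)) opprB addrA subrK.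
  by rewrite -[x - y]/(x + - y).
apply: le_trans (space_normD (BzX x) NyX) _; rewrite lerD2l.
by rewrite (space_normZ _ (BzX y)) normrN1 mul1r.
Qed.

Lemma target_approx (z : 'I_d -> seqsp V X) (eps : R) : 0 < eps ->
  exists s : {ffun 'I_d -> seq nat}, forall i,
    space_norm X (fun k => z i k - target s i k) <= eps.
Proof.
move=> eps0; have e20 : 0 < eps / 2 by rewrite divr_gt0.
have /choice[s sP] : forall i, exists s : seq nat,
    space_norm X (fun k => z i k -
      (if (k < size s)%N then e (nth 0%N s k) else 0)) <= eps.
  move=> i; have [N NP] := space_norm_tail (seqspP (z i)) e20.
  have N1 : 0 < N.+1%:R :> R by rewrite ltr0n.
  have /choice[r rP] : forall k, exists n, `|z i k - e n| <= eps / 2 / N.+1%:R.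
    by move=> k; apply: e_dense; rewrite divr_gt0.
  exists (mkseq r N); rewrite size_mkseq.
  (* The [N] approximated entries cost at most [eps / 2] in l^1, the discarded tail at most
     [eps / 2] in [X]. *)
  pose hd k := if (k < N)%N then z i k - e (r k) else 0.
  pose tl k := if (k < N)%N then 0 else z i k.
  have hdE : forall L, \sum_(0 <= k < L) `|hd k| <= eps / 2.
    move=> L; have := @sum_head_tail_le R (fun k => `|hd k|) N.+1 N L
      (eps / 2 / N.+1%:R) 0 isT.
    rewrite mulr0 mul0r addr0 => /(_ _ _ _ _)/le_trans; apply => //.
    - by rewrite ltW// divr_gt0.
    - by move=> h _; rewrite /hd; case: ifP => // _; rewrite normr0.
    - by move=> h Nh; rewrite /hd ltnNge (ltnW Nh) normr0 mul0r.
    - by rewrite mulrCA ler_piMr ?(ltW e20)// ler_pdivrMr// mul1r ler_nat.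
  have tlX : in_space X tl.
    apply: in_space_le (seqspP (z i)) => k; rewrite /tl.
    by case: ifP => // _; rewrite normr0.
  have -> : (fun k => z i k - (if (k < N)%N then e (nth 0%N (mkseq r N) k) else 0))
      = hd + tl.
    apply/funext => k; rewrite -[RHS]/(hd k + tl k) /hd /tl.
    by case: ltnP => kN; rewrite ?nth_mkseq// ?addr0 ?add0r ?subr0.
  rewrite (le_trans (space_normD (in_space_l1 X hdE) tlX))//.
  by rewrite [leRHS]splitr; apply: lerD NP; exact: space_norm_l1.
exists [ffun i => s i] => i; rewrite /target.
by under eq_fun do rewrite ffunE; exact: sP.
Qed.

End Targets.

(** * The common hypercyclic vector *)

Theorem corollary1p5 (R : realType) (K : scalar_field) (X : seq_space R)
    (d : nat) (beta : R) (Lambda : set 'rV[R]_d) (alpha : R)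
    (w : R -> nat -> R) :
  (0 < d)%N ->
  0 < beta <= 1 ->
  holder_curve beta Lambda ->
  (forall lam, Lambda lam -> forall i : 'I_d, 0 < lam ord0 i) ->
  0 < alpha ->
  (forall (x : R) (n : nat), 0 < x -> (0 < n)%N -> 0 < w x n) ->
  (forall (x : R) (n : nat), 0 < x -> (0 < n)%N ->
    \prod_(1 <= k < n.+1) w x k = expR (x * n%:R `^ alpha)) ->
  alpha <= beta ->
  (\bigcap_(lam in Lambda)
    hypercyclic_vectors
      (prod_op (fun i : 'I_d => @wshift R (scalars R K) X (w (lam ord0 i)))))
  !=set0.
Proof.
move=> _ /andP[beta0 beta1] [f [rho rho0 fH] LE] Lpos al0 w0 wE alb.
have al01 : 0 < alpha <= 1 by rewrite al0 (le_trans alb).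
pose g (i : 'I_d) (t : R) := f t ord0 i.
have gH i (s t : R) : 0 <= s <= 1 -> 0 <= t <= 1 ->
    `|g i s - g i t| <= rho * `|s - t| `^ alpha.
  move=> s01 t01; have -> : g i s - g i t = (f s - f t) ord0 i by rewrite !mxE.
  rewrite (le_trans (row_entry_norm_le _ _))// (le_trans (fH _ _ _ _)) ?in_itv//.
  (* Since [|s - t| <= 1], lowering the exponent from [beta] to [alpha] weakens the bound. *)
  rewrite ler_wpM2l ?(ltW rho0)//; have [->|st] := eqVneq s t.
    by rewrite subrr normr0 !powR0 ?gt_eqF.
  apply: ger_powR => //; rewrite normr_gt0 subr_eq0 st/= ler_norml.
  by move: s01 t01 => /andP[s0 s1] /andP[t0 t1]; apply/andP; split; lra.
have gpos i (t : R) : 0 <= t <= 1 -> 0 < g i t.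
  by move=> t01; apply: Lpos; rewrite LE; exists t => //=; rewrite in_itv.
have [a [b [a0 b0 gb]]] := holder_bounds rho0 al0 gH gpos.
have [e e_dense] := scalars_separable R K.
(* Only the exponent of 2 in [m] is decoded, so every target recurs for arbitrarily large [m], where
   the error [2 * 2^-m] is small. *)
pose code m : {ffun 'I_d -> seq nat} :=
  odflt [ffun=> [::]] (unpickle (logn 2 m)).
have codeP s m0 : exists2 m, (m0 <= m)%N & code m = s.
  exists (2 ^ pickle s * 3 ^ m0)%N.
    by rewrite (leq_trans (ltnW (ltn_expl m0 (isT : 1 < 3)%N)))// leq_pmull// expn_gt0.
  rewrite /code lognM ?expn_gt0// pfactorK// logn_coprime ?coprimeXr//.
  by rewrite addn0 pickleK.
have [u [u2 uP]] := exists_common_vector al01 rho0 a0 b0 gb gH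
  (fun m => @target_support _ _ _ e (code m)).
pose U i : seqsp (scalars R K) X := Seqsp (asboolT (in_space_l1 X (u2 i))).
exists U => lam; rewrite LE => -[t /=]; rewrite in_itv/= => t01 <-.
move=> O [y Oy] Oo; apply: (ptws_dense_hit Oo Oy) => eps eps0.
have eps20 : 0 < eps / 2 by rewrite divr_gt0.
have [s sP] := target_approx e_dense y eps20.
have [m0 m0P] : exists m0, 2 * 2^-1 ^+ m0 <= eps / 2 :> R.
  pose r := (Num.trunc (4 / eps)).+1; exists r.
  have rP : 4 / eps <= 2 ^+ r.
    rewrite (le_trans (ltW (truncnS_gt _)))// -natrX ler_nat.
    exact: ltnW (ltn_expl r (isT : 1 < 2)%N).
  rewrite exprVn ler_pdivrMr ?exprn_gt0// mulrAC ler_pdivlMr//.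
  by move: rP; rewrite ler_pdivrMr// mulrC; lra.
have [m m0m mE] := codeP s m0.
have [n nP] := uP m t t01; rewrite mE in nP.
have iterE i : (iter n (prod_op (fun i => wshift (w (f t ord0 i)))) U i : nat -> _)
    = bshift alpha (g i t) n (u i).
  rewrite iter_prod_op; apply/funext => k.
  exact: (iter_wshiftE al01 (gpos i t t01) (fun n => w0 _ n (gpos i t t01))
    (fun n => wE _ n (gpos i t t01))).
exists (iter n (prod_op (fun i => wshift (w (f t ord0 i)))) U); first by exists n.
move=> i.
(* Both [y] and the iterate are within [eps / 2] of the target coded by [s]. *)
apply: le_trans (seqsp_norm_valB _ _ (target_in_space X e s i)) _.
rewrite [leRHS]splitr; apply: lerD (sP i) _.
rewrite iterE; apply: space_norm_l1 => L.
apply: le_trans (nP i L) (le_trans _ m0P); rewrite ler_wpM2l//.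
by apply: ler_wiXn2l => //; lra.
Qed.
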